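(* Every tree-like single-coalition-first neighborhood model $z$-represents a tree-like grand-coalition-first action model; that is, for every tree-like single-coalition-first neighborhood model $N$ there is a tree-like grand-coalition-first action model $M$ that is $z$-representable by $N$.
   Context: $AG$ is a finite nonempty set of agents, $AP$ a countable set of atomic propositions. For a nonempty set $AC$ and $C\subseteq AG$, $JA_C$ is the set of functions $\sigma_C:C\to AC$ ($JA_\emptyset=\{\emptyset\}$); $\sigma_C\subseteq\sigma_{AG}$ means $\sigma_C$ is the restriction of $\sigma_{AG}$ to $C$. A grand-coalition-first action model is $M=(ST,AC,out_{AG},L)$ with $ST,AC$ nonempty, $out_{AG}:ST\times JA_{AG}\to\mathcal P(ST)$, $L:ST\to\mathcal P(AP)$. It determines $out_C(s,\sigma_C)=\bigcup\{out_{AG}(s,\sigma_{AG})\mid\sigma_C\subseteq\sigma_{AG}\}$, $av_C(s)=\{\sigma_C\mid out_C(s,\sigma_C)\neq\emptyset\}$, $AE_C(s)=\{out_C(s,\sigma_C)\mid\sigma_C\in av_C(s)\}$. An $AG$-history from $s_0$ to $s_n$ is $(s_0)$ (from $s_0$ to $s_0$) or $(s_0,\sigma^1,s_1,\dots,\sigma^n,s_n)$, $n\ge1$, with $\sigma^{i+1}\in av_{AG}(s_i)$, $s_{i+1}\in out_{AG}(s_i,\sigma^{i+1})$. $M$ is tree-like if there is $r\in ST$ such that for every $s\in ST$ there is a unique $AG$-history from $r$ to $s$. A single-coalition-first neighborhood model is $N=(ST,suc,\{nei_a\}_{a\in AG},L)$ with $ST$ nonempty, $suc:ST\to\mathcal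 P(ST)$, $L:ST\to\mathcal P(AP)$, each $nei_a(s)\subseteq\mathcal P(ST)$ a cover of $suc(s)$ (union $suc(s)$, $\emptyset\notin nei_a(s)$). With $\Delta_1\odot\Delta_2=\{Y_1\cap Y_2\mid Y_i\in\Delta_i,Y_1\cap Y_2\neq\emptyset\}$ (extended to finitely many families, $\bigodot\{\Delta\}=\Delta$): $nei_C(s)=\emptyset$ if $suc(s)=\emptyset$; $\{suc(s)\}$ if $suc(s)\neq\emptyset$, $C=\emptyset$; $\bigodot\{nei_a(s)\mid a\in C\}$ otherwise. A $C$-history in $N$ from $s_0$ to $s_n$ is $(s_0)$ or $(s_0,Y_1,s_1,\dots,Y_n,s_n)$, $n\ge1$, with $Y_{i+1}\in nei_C(s_i)$, $s_{i+1}\in Y_{i+1}$. $N$ is tree-like if there is $r\in ST$ such that for every $a\in AG$ and $s\in ST$ there is a unique $\{a\}$-history from $r$ to $s$. $M$ is $z$-representable by $N$ ($N$ $z$-represents $M$) if they share $ST$ and $L$ and $AE_C=nei_C$ for all $C\subseteq AG$. *)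

(* Defs.v *)
From mathcomp Require Import all_boot.
From mathcomp Require Import boolp classical_sets.
Set Implicit Arguments.
Unset Strict Implicit.
Unset Printing Implicit Defensive.

Local Open Scope classical_set_scope.

Section Defs.
Variables (AG : finType) (AP : countType) (ST : Type).

(* [history step s0 h s]: the alternating sequence
   (s0, x1, s1, ..., xn, sn) encoded by h = [:: (x1, s1); ...; (xn, sn)]
   is a history from s0 to s = sn; the empty h encodes (s0). *)
Fixpoint history (X : Type) (step : ST -> X -> ST -> Prop)
    (s0 : ST) (h : seq (X * ST)) (s : ST) : Prop :=
  if h is (x, s1) :: h' then step s0 x s1 /\ history step s1 h' s
  else s0 = s.

Definition joint_action (AC : Type) (C : {set AG}) := {a : AG | a \in C} -> AC.

Definition AGset : {set AG} := finset.setTfor AG.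

Definition restriction (AC : Type) (C : {set AG})
    (sAG : joint_action AC AGset) : joint_action AC C :=
  fun a => sAG (exist _ (sval a) (finset.in_setT (sval a))).

Record action_model := ActionModel {
  am_AC : Type;
  am_ST_nonempty : inhabited ST;
  am_AC_nonempty : inhabited am_AC;
  am_out : ST -> joint_action am_AC AGset -> set ST;
  am_label : ST -> set AP }.

Section ActionModel.
Variable M : action_model.

Definition out_coal (C : {set AG}) (s : ST)
    (sC : joint_action (am_AC M) C) : set ST :=
  \bigcup_(sAG in [set sAG | sC = restriction sAG]) am_out s sAG.

Definition av_coal (C : {set AG}) (s : ST) : set (joint_action (am_AC M) C) :=
  [set sC | out_coal s sC !=set0].

Definition AE (C : {set AG}) (s : ST) : set (set ST) :=
  [set out_coal s sC | sC in @av_coal C s].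

Definition am_step (s : ST) (sAG : joint_action (am_AC M) AGset) (s' : ST) :=
  av_coal s sAG /\ am_out s sAG s'.

Definition am_tree_like : Prop :=
  exists r : ST, forall s : ST, exists! h, history am_step r h s.

End ActionModel.

Record neighborhood_model := NeighborhoodModel {
  nm_ST_nonempty : inhabited ST;
  nm_suc : ST -> set ST;
  nm_nei : AG -> ST -> set (set ST);
  nm_nei_bigcup : forall a s, \bigcup_(Y in nm_nei a s) Y = nm_suc s;
  nm_nei_set0 : forall a s, ~ nm_nei a s set0;
  nm_label : ST -> set AP }.

Definition odot (D1 D2 : set (set ST)) : set (set ST) :=
  [set Y | exists Y1 Y2,
    [/\ D1 Y1, D2 Y2, Y = Y1 `&` Y2 & Y1 `&` Y2 !=set0]].

Section NeighborhoodModel.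
Variable N : neighborhood_model.

(* [set setT] is neutral for odot on families without an empty member, such as
   all nm_nei a s; so for nonempty C the big operator is the iterated odot of
   the indexed family, and equals nm_nei a s when C is the singleton of a. *)
Definition nei_coal (C : {set AG}) (s : ST) : set (set ST) :=
  if `[< nm_suc N s = set0 >] then set0
  else if C == finset.set0 then [set nm_suc N s]
  else \big[odot/[set setT]]_(a in C) nm_nei N a s.

Definition nm_step (C : {set AG}) (s : ST) (Y : set ST) (s' : ST) : Prop :=
  nei_coal C s Y /\ Y s'.

Definition nm_tree_like : Prop :=
  exists r : ST, forall (a : AG) (s : ST),
    exists! h, history (nm_step (finset.set1 a)) r h s.

End NeighborhoodModel.

Definition z_representable (M : action_model) (N : neighborhood_model) : Prop :=
  am_label M = nm_label N /\ forall C : {set AG}, AE M C = nei_coal N C.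

End Defs.

(* Main.v *)
(** Let the actions of each agent be the subsets of [ST]: at a state [s], agent
    [a] picks a neighborhood in [nei_a(s)], and the outcome of a joint choice is
    the intersection of the chosen neighborhoods (empty if some agent's choice
    is not a neighborhood at [s]). Since each [nei_a(s)] covers [suc(s)], any
    successor lying in the choices of a coalition is reached by some completion
    of these choices, so [AE_C = nei_C]. An [AG]-history projects to an
    [{a}]-history for every agent [a] and is determined by these projections,
    so uniqueness of histories passes from the neighborhood model to the action
    model. *)
Require Import Defs.
From mathcomp Require Import all_boot.
From mathcomp Require Import boolp classical_sets.
Set Implicit Arguments.
Unset Strict Implicit.
Unset Printing Implicit Defensive.

Local Open Scope classical_set_scope.

(** Nonemptiness needs checking only once, at the end: each partial intersection formed by [odot]
    contains the final one. For the empty family the intersection is [setT], which is nonempty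
    because [ST] is inhabited. *)
Lemma big_odotP (ST : Type) (I : eqType) (r : seq I) (P : pred I)
    (F : I -> set (set ST)) (Y : set ST) :
    inhabited ST -> uniq r ->
  (\big[@odot ST/[set setT]]_(i <- r | P i) F i) Y <->
  Y !=set0 /\ exists f : I -> set ST,
    (forall i, i \in r -> P i -> F i (f i)) /\
    Y = [set x | forall i, i \in r -> P i -> f i x].
Proof.
move=> [x0]; elim: r Y => [|j r IHr] Y /=.
  move=> _; rewrite big_nil; split=> [->|[_ [f [_ ->]]]].
    split; first by exists x0.
    by exists (fun=> setT); split=> //; apply/seteqP; split.
  by apply/seteqP; split.
case/andP=> jr ur; rewrite big_cons; case: ifP => Pj; last first.
  rewrite IHr //; split=> -[Y0 [f [Ff YE]]]; split=> //; exists f.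
    split=> [i|]; first by rewrite inE => /predU1P[->|/Ff//]; rewrite Pj.
    rewrite YE; apply/seteqP; split=> x fx i.
      by rewrite inE => /predU1P[->|/fx//]; rewrite Pj.
    by move=> ir; apply: fx; rewrite inE ir orbT.
  split=> [i ir|]; first by apply: Ff; rewrite inE ir orbT.
  rewrite YE; apply/seteqP; split=> x fx i.
    by move=> ir; apply: fx; rewrite inE ir orbT.
  by rewrite inE => /predU1P[->|/fx//]; rewrite Pj.
split=> [[Y1 [Y2 [FY1 /IHr-/(_ ur)[_ [f [Ff ->]]] -> Y0]]]|].
  (* Overriding [f] at [j] leaves the choices along [r] intact, since [uniq] excludes [j] from
     [r]. *)
  split=> //; exists (fun i => if i == j then Y1 else f i); split=> [i|].
    by rewrite inE; case: eqP => [->|_ /=] //; apply: Ff.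
  apply/seteqP; split=> x /=.
    by move=> [Y1x fx] i; rewrite inE; case: eqP => [->|_ /=] //; apply: fx.
  move=> fx; split=> [|i ir Pi].
    by have := fx j; rewrite inE eqxx; apply.
  have := fx i; rewrite inE ir orbT; case: eqP => [ij|_]; last exact.
  by move: jr; rewrite -ij ir.
move=> [[x Yx] [f [Ff YE]]].
have YI : Y = f j `&` [set x | forall i, i \in r -> P i -> f i x].
  rewrite YE; apply/seteqP; split=> y /=.
    move=> fy; split=> [|i ir]; apply: fy => //; first by rewrite inE eqxx.
    by rewrite inE ir orbT.
  by move=> [fjy fy] i; rewrite inE => /predU1P[->|/fy].
exists (f j), [set x | forall i, i \in r -> P i -> f i x]; split=> //.
- by apply: Ff => //; rewrite inE eqxx.
- apply/IHr => //; split; first by move: Yx; rewrite YI => -[_ ?]; exists x.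
  by exists f; split=> // i ir; apply: Ff; rewrite inE ir orbT.
- by rewrite -YI; exists x.
Qed.

Section Neighborhoods.
Variables (AG : finType) (AP : countType) (ST : Type).
Variable N : neighborhood_model AG AP ST.

Lemma nei_sub_suc a s Y x : nm_nei N a s Y -> Y x -> nm_suc N s x.
Proof. by move=> nY Yx; rewrite -(nm_nei_bigcup N a s); exists Y. Qed.

Lemma suc_nei a s x : nm_suc N s x -> exists Y, nm_nei N a s Y /\ Y x.
Proof. by rewrite -(nm_nei_bigcup N a s) => -[Y nY Yx]; exists Y. Qed.

(** One formula for the three cases of [nei_coal]: intersecting with [suc(s)] yields [suc(s)] itself
    for empty [C], rules out any nonempty [Y] when [suc(s)] is empty, and changes nothing for
    nonempty [C], whose neighborhoods lie inside [suc(s)]. *)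
Lemma nei_coalP (C : {set AG}) s Y :
  nei_coal N C s Y <->
  Y !=set0 /\ exists f : AG -> set ST,
    (forall a, a \in C -> nm_nei N a s (f a)) /\
    Y = [set x | nm_suc N s x /\ forall a, a \in C -> f a x].
Proof.
rewrite /nei_coal; case: asboolP => [suc0|/eqP suc0].
  by split=> // -[[x Yx] [f [_ YE]]]; move: Yx; rewrite YE suc0 => -[].
case: eqVneq => [->|/finset.set0Pn[b bC]].
  split=> [->|[_ [f [_ ->]]]].
    split; first exact/set0P.
    exists (fun=> setT); split=> [a|]; first by rewrite finset.in_set0.
    by apply/seteqP; split=> x /=; [split=> // a; rewrite finset.in_set0|case].
  by apply/seteqP; split=> x /=; [case|split=> // a; rewrite finset.in_set0].
rewrite big_odotP; [|exact: nm_ST_nonempty N|exact: index_enum_uniq].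
have bI : b \in index_enum AG by exact: mem_index_enum.
split=> -[Y0 [f [Ff YE]]]; split=> //; exists f.
  split=> [a aC|]; first by apply: Ff => //; exact: mem_index_enum.
  rewrite YE; apply/seteqP; split=> x /=; last by move=> [_ fx] a _; apply: fx.
  move=> fx; split=> [|a aC]; last by apply: fx => //; exact: mem_index_enum.
  exact: nei_sub_suc (Ff b bI bC) (fx b bI bC).
split=> [a _|]; first exact: Ff.
rewrite YE; apply/seteqP; split=> x /=; first by move=> [_ fx] a _; apply: fx.
move=> fx; split=> [|a aC]; last by apply: fx => //; exact: mem_index_enum.
exact: nei_sub_suc (Ff b bC) (fx b bI bC).
Qed.

Lemma nei_coal1 a s : nei_coal N (finset.set1 a) s = nm_nei N a s.
Proof.
apply/seteqP; split=> Y.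
  move=> /nei_coalP[_ [f [Ff ->]]].
  have fa : nm_nei N a s (f a) by apply: Ff; rewrite finset.in_set1.
  rewrite [X in nm_nei N a s X](_ : _ = f a) //; apply/seteqP; split=> x /=.
    by move=> [_]; apply; rewrite finset.in_set1.
  move=> fx; split; first exact: nei_sub_suc fa fx.
  by move=> b; rewrite finset.in_set1 => /eqP->.
move=> nY; apply/nei_coalP; split.
  by apply/set0P/eqP => Y0; move: nY; rewrite Y0; exact: nm_nei_set0.
exists (fun=> Y); split=> [b|]; first by rewrite finset.in_set1 => /eqP->.
apply/seteqP; split=> x /=.
  by move=> Yx; split=> //; exact: nei_sub_suc nY Yx.
by move=> [_]; apply; rewrite finset.in_set1.
Qed.

Definition nei_action_out (s : ST) (sAG : joint_action (set ST) (AGset AG)) :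
    set ST :=
  [set x | nm_suc N s x /\
           forall u, nm_nei N (sval u) s (sAG u) /\ sAG u x].

Definition nei_action_model : action_model AG AP ST :=
  ActionModel (nm_ST_nonempty N) (inhabits (@set0 ST)) nei_action_out
    (nm_label N).

(** The completion of [sC] may depend on the outcome [x], so the agents outside [C] impose no
    constraint on the union over all completions beyond membership in [suc(s)]. *)
Lemma out_coal_nei (C : {set AG}) s (sC : joint_action (set ST) C) :
  out_coal (M := nei_action_model) s sC =
  [set x | nm_suc N s x /\
           forall u, nm_nei N (sval u) s (sC u) /\ sC u x].
Proof.
apply/seteqP; split=> x /=.
  by move=> [sAG /= -> [sx sAGx]]; split=> // u; exact: sAGx (exist _ _ _).
move=> [sx sCx].
(* Each agent outside [C] plays a neighborhood containing [x]; [insub] decides membership in [C]. *)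
have [g gP] := choice (fun a => suc_nei a sx).
exists (fun u => if insub (sval u) is Some v then sC v else g (sval u)) => /=.
  by apply: funext => u; rewrite /restriction /= (valK u).
split=> // -[a aAG] /=; case: insubP => [v _ /= <-|_]; first exact: sCx.
exact: gP.
Qed.

Lemma AE_nei_action_model (C : {set AG}) : AE nei_action_model C = nei_coal N C.
Proof.
apply: funext => s; apply/seteqP; split=> Y.
  move=> [sC]; rewrite /av_coal /= => Y0 <-; apply/nei_coalP; split=> //.
  (* A single outcome [y] certifies that every choice in [sC] is a neighborhood at [s]. *)
  move: Y0; rewrite out_coal_nei => -[y [_ sCy]].
  (* The value [set0] is a dummy: only agents of [C] are ever consulted. *)
  exists (fun a => if insub a is Some v then sC v else set0); split=> [a aC|].
    by rewrite insubT /=; case: (sCy (exist _ a aC)).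
  apply/seteqP; split=> x /= -[sx fx]; split=> //.
    by move=> a aC; rewrite insubT; case: (fx (exist _ a aC)).
  move=> u; split; first by case: (sCy u).
  by have := fx _ (valP u); rewrite valK.
move=> /nei_coalP[Y0 [f [Ff YE]]].
have outE : out_coal (M := nei_action_model) s
    (fun u : {a | a \in C} => f (sval u)) = Y.
  rewrite out_coal_nei YE; apply/seteqP; split=> x /= -[sx fx]; split=> //.
    by move=> a aC; case: (fx (exist _ a aC)).
  by move=> [a aC] /=; split; [apply: Ff|apply: fx].
by exists (fun u => f (sval u)) => //; rewrite /av_coal /= outE.
Qed.

Lemma am_step_nei s (sAG : joint_action (set ST) (AGset AG)) s' :
  am_step (M := nei_action_model) s sAG s' <-> nei_action_out s sAG s'.
Proof.
split=> [[]//|outs]; split=> //; exists s'.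
by rewrite out_coal_nei.
Qed.

Definition agent (a : AG) : {b : AG | b \in AGset AG} :=
  exist _ a (finset.in_setT a).

Definition proj_history (a : AG)
    (h : seq (joint_action (set ST) (AGset AG) * ST)) : seq (set ST * ST) :=
  [seq (p.1 (agent a), p.2) | p <- h].

Lemma history_proj a r h s :
  history (am_step (M := nei_action_model)) r h s ->
  history (nm_step N (finset.set1 a)) r (proj_history a h) s.
Proof.
elim: h r => //= -[sAG s1] h IHh r [/am_step_nei[_ out1] /IHh hs]; split=> //.
by rewrite /nm_step nei_coal1; exact: out1 (agent a).
Qed.

(** The length and the states can be read off the projection to any one agent, which is why an agent
    must exist; the joint actions are recovered componentwise from all projections. *)
Lemma proj_history_inj h1 h2 : 0 < #|AG| ->
  (forall a, proj_history a h1 = proj_history a h2) -> h1 = h2.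
Proof.
move=> /card_gt0P[a0 _].
elim: h1 h2 => [|[f1 s1] h1 IHh] [|[f2 s2] h2] // eqh; try by have := eqh a0.
have [_ -> _] := eqh a0; rewrite (IHh h2) => [|a]; last by case: (eqh a).
congr ((_, _) :: _); apply: funext => u.
by rewrite (_ : u = agent (sval u)); [case: (eqh (sval u))|exact: val_inj].
Qed.

(** Only the states of [h] are kept: at each step every agent, [a] included, is given some
    neighborhood containing the next state. This suffices for existence of an [AG]-history. *)
Lemma history_lift a r h s :
  history (nm_step N (finset.set1 a)) r h s ->
  exists h', history (am_step (M := nei_action_model)) r h' s.
Proof.
elim: h r => [|[Y s1] h IHh] r /=; first by exists [::].
rewrite /nm_step nei_coal1 => -[[nY Ys1] /IHh[h' hs]].
have rs1 := nei_sub_suc nY Ys1.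
have [g gP] := choice (fun b => suc_nei b rs1).
exists ((fun u => g (sval u), s1) :: h'); split=> //.
by apply/am_step_nei; split.
Qed.

Lemma nei_action_model_tree_like :
  0 < #|AG| -> nm_tree_like N -> am_tree_like nei_action_model.
Proof.
move=> AG0 [r rP]; exists r => s.
(* Existence comes from lifting the history of one arbitrary agent; uniqueness then uses all
   agents. *)
have /card_gt0P[a _] := AG0.
have [h [/history_lift[h1 h1P] _]] := rP a s; exists h1; split=> // h2 h2P.
apply: proj_history_inj => // b; have [hb [_ hb_uniq]] := rP b s.
by rewrite -(hb_uniq _ (history_proj b h1P)) -(hb_uniq _ (history_proj b h2P)).
Qed.

End Neighborhoods.

Theorem theorem6p10 (AG : finType) (AP : countType) (AG_nonempty : 0 < #|AG|)
    (ST : Type) (N : neighborhood_model AG AP ST) :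
  nm_tree_like N ->
  exists M : action_model AG AP ST, am_tree_like M /\ z_representable M N.
Proof.
move=> N_tree; exists (nei_action_model N); split.
  exact: nei_action_model_tree_like.
by split=> // C; exact: AE_nei_action_model.
Qed.
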